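(* Suppose $\xi_{\mathbf P}>0$ for all $\mathbf P\in\mathcal P$ and that $(\mathcal P,\mathcal Q,\mathcal R)$ is anova-applicable. Let $\mathbf R\in\mathcal R$ and put $$\theta_{\mathbf R}=\sum_{\mathbf Q\in\mathcal Q:\,\lambda_{\mathbf{QR}}\ne0}\lambda_{\mathbf{QR}}\,(\xi_{c(\mathbf Q)}+r\eta_{\mathbf Q})^{-1}.$$ Then the generalized least squares estimator $(\mathbf R\mathbf V^{-1}\mathbf R)^{-}\mathbf R\mathbf V^{-1}\mathbf Y$ of $\mathbf R\mathbf X_f\mathbf X_h\boldsymbol\tau$ is $$\mathbf R\mathbf X_f\mathbf X_h\widehat{\boldsymbol\tau}=\theta_{\mathbf R}^{-1}\sum_{\mathbf Q\in\mathcal Q:\,\lambda_{\mathbf{QR}}\ne0}(\xi_{c(\mathbf Q)}+r\eta_{\mathbf Q})^{-1}\mathbf{RQ}\mathbf Y,$$ and its variance matrix is $\theta_{\mathbf R}^{-1}\mathbf R$.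
   Context: Setting (chain of two randomizations). $\Omega,\Upsilon,\Gamma$ are finite sets, $f\colon\Omega\to\Upsilon$ and $h\colon\Upsilon\to\Gamma$ are surjective maps, and $f$ is equireplicate: every element of $\Upsilon$ has exactly $r$ preimages. $\mathbf X_f$ is the $\Omega\times\Upsilon$ matrix with $(\omega,\upsilon)$-entry $1$ if $f(\omega)=\upsilon$ and $0$ otherwise; $\mathbf X_h$ is the analogous $\Upsilon\times\Gamma$ matrix; $\mathbf D_h=\mathbf X_h'\mathbf X_h$. Primes denote transposes. A transitive permutation group $G$ on a finite set $S$ is stratifiable if the symmetric $0$-$1$ matrices of its symmetrized orbits on $S\times S$ all commute; the orthogonal projectors onto their common eigenspaces (strata) are its stratum projectors. $\mathcal P$ is the set of stratum projectors ($\Omega\times\Omega$ nonzero symmetric, mutually orthogonal idempotents summing to $\mathbf I_\Omega$) of a transitive stratifiable group $G_1$ on $\Omega$. $\mathcal Q$ arises from the stratum projectors $\mathbf Q_\Upsilon$ ($\Upsilon\times\Upsilon$, summing to $\mathbf I_\Upsilon$) of a transitive stratifiable group $G_2$ on $\Upsilon$ (or from a refinement in which some of these are replaced by mutually orthogonal nonzero symmetric sub-idempotents summing to them, all pieces keeping the same coefficient $\eta$): each $\mathbf Q_\Upsilon$ is replaced by the $\Omega\times\Omega$ matrix $\mathbf Q=r^{-1}\mathbf X_f\mathbf Q_\Upsilon\mathbf X_f'$. These are mutually orthogonal symmetric idempotents with sum $\mathbf I_{\mathcal Q}=r^{-1}\mathbf X_f\mathbf X_f'$. $\mathcal R$ arises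 from a set of nonzero symmetric, mutually orthogonal $\Upsilon\times\Upsilon$ idempotents $\mathbf R_\Upsilon$ with sum $\mathbf X_h\mathbf D_h^{-1}\mathbf X_h'$, each replaced by $\mathbf R=r^{-1}\mathbf X_f\mathbf R_\Upsilon\mathbf X_f'$; put $\mathbf I_{\mathcal R}=\sum_{\mathbf R\in\mathcal R}\mathbf R$. Model. $\mathbf Y=\mathbf Z+\mathbf X_f\mathbf W+\mathbf X_f\mathbf X_h\boldsymbol\tau$, where $\boldsymbol\tau\in\mathbb R^\Gamma$ is a fixed vector, $\mathbf Z$ (indexed by $\Omega$) and $\mathbf W$ (indexed by $\Upsilon$) are independent random vectors with mean zero, $\operatorname{Cov}(\mathbf Z)=\sum_{\mathbf P}\xi_{\mathbf P}\mathbf P$ and $\operatorname{Cov}(\mathbf W)=\sum\eta_{\mathbf Q}\mathbf Q_\Upsilon$ with $\xi_{\mathbf P},\eta_{\mathbf Q}\ge 0$. Thus $\operatorname E(\mathbf Y)=\mathbf X_f\mathbf X_h\boldsymbol\tau$ and $\operatorname{Cov}(\mathbf Y)=\mathbf V=\sum_{\mathbf P\in\mathcal P}\xi_{\mathbf P}\mathbf P+r\sum_{\mathbf Q\in\mathcal Q}\eta_{\mathbf Q}\mathbf Q$. The coefficients $\xi_{\mathbf P},\eta_{\mathbf Q}$ are regarded as known. Structure balance (assumed). $\mathcal Q$ is structure balanced in relation to $\mathcal P$: there are scalars $\lambda_{\mathbf{PQ}}$ with $\mathbf Q\mathbf P\mathbf I_{\mathcal Q}=\lambda_{\mathbf{PQ}}\mathbf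 Q$ for all $\mathbf P\in\mathcal P$, $\mathbf Q\in\mathcal Q$. $\mathcal R$ is structure balanced in relation to $\mathcal Q$: there are scalars $\lambda_{\mathbf{QR}}$ with $\mathbf R\mathbf Q\mathbf I_{\mathcal R}=\lambda_{\mathbf{QR}}\mathbf R$ for all $\mathbf Q\in\mathcal Q$, $\mathbf R\in\mathcal R$. $\mathcal Q_1$ is the set of $\mathbf Q\in\mathcal Q$ for which there is $\mathbf P\in\mathcal P$ with $\lambda_{\mathbf{PQ}}=1$; this $\mathbf P$ is unique and is denoted $c(\mathbf Q)$. The triple $(\mathcal P,\mathcal Q,\mathcal R)$ is anova-applicable if for every $\mathbf Q\in\mathcal Q$ with $\mathbf Q\mathbf I_{\mathcal R}\ne\mathbf 0$ we have $\mathbf Q\in\mathcal Q_1$. (If $\lambda_{\mathbf{QR}}\neq0$ then $\mathbf Q\mathbf I_{\mathcal R}\neq\mathbf 0$, so $c(\mathbf Q)$ is defined for every $\mathbf Q$ in the sums.) $\mathbf A^{-}$ denotes the Moore–Penrose generalized inverse of $\mathbf A$. *)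

(* Defs.v *)
From HB Require Import structures.
From mathcomp Require Export all_boot all_order all_algebra all_fingroup.
From mathcomp Require Export all_classical all_reals all_analysis.

Set Implicit Arguments.
Unset Strict Implicit.
Unset Printing Implicit Defensive.

Export Order.TTheory GRing.Theory Num.Theory.
Export numFieldNormedType.Exports.

Local Open Scope classical_set_scope.
Local Open Scope ring_scope.

Definition surjective_map (A B : Type) (f : A -> B) : Prop :=
  forall b, exists a, f a = b.

Definition equireplicate (n m r : nat) (f : 'I_n -> 'I_m) : Prop :=
  forall u : 'I_m, #|[set w : 'I_n | f w == u]%SET| = r.

                     
Definition incidence (R : realType) (n m : nat) (f : 'I_n -> 'I_m) : 'M[R]_(n, m) :=
  \matrix_(w, u) (f w == u)%:R.

Definition is_moore_penrose (R : realType) (p q : nat)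
    (A : 'M[R]_(p, q)) (B : 'M[R]_(q, p)) : Prop :=
  [/\ A *m B *m A = A, B *m A *m B = B,
      (A *m B)^T = A *m B & (B *m A)^T = B *m A].

                                                                           
                                            
Definition moore_penrose (R : realType) (p q : nat) (A : 'M[R]_(p, q)) :
    'M[R]_(q, p) :=
  xget 0 [set B | is_moore_penrose A B].

Definition pair_orbit (n : nat) (G : {group 'S_n}) (x : 'I_n * 'I_n) :
    {set 'I_n * 'I_n} :=
  [set (g x.1, g x.2) | g : 'S_n in G]%SET.

Definition symmetrized_orbit (n : nat) (G : {group 'S_n}) (x : 'I_n * 'I_n) :
    {set 'I_n * 'I_n} :=
  (pair_orbit G x :|: pair_orbit G (x.2, x.1))%SET.

Definition symmetrized_orbit_mx (R : realType) (n : nat) (G : {group 'S_n})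
    (x : 'I_n * 'I_n) : 'M[R]_n :=
  \matrix_(i, j) ((i, j) \in symmetrized_orbit G x)%:R.

Definition transitive_perm (n : nat) (G : {group 'S_n}) : bool :=
  [transitive G, on [set: 'I_n]%SET | 'P].

Definition stratifiable (R : realType) (n : nat) (G : {group 'S_n}) : Prop :=
  forall x y : 'I_n * 'I_n,
    comm_mx (symmetrized_orbit_mx R G x) (symmetrized_orbit_mx R G y).

                                                                              
                                                                                
                                                     
Definition stratum_projector (R : realType) (n : nat) (G : {group 'S_n})
    (E : 'M[R]_n) : Prop :=
  [/\ E^T = E, E *m E = E, E != 0 &
      exists alpha : 'I_n * 'I_n -> R,
        (E :=: \bigcap_(x : 'I_n * 'I_n)
                  eigenspace (symmetrized_orbit_mx R G x) (alpha x))%MS].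

                                                                        
Definition stratum_projectors (R : realType) (n : nat) (G : {group 'S_n})
    (I : finType) (E : I -> 'M[R]_n) : Prop :=
  injective E /\ (forall M : 'M[R]_n, stratum_projector G M <-> exists i, E i = M).

Definition orthogonal_idempotents (R : realType) (n : nat)
    (I : finType) (E : I -> 'M[R]_n) : Prop :=
  [/\ forall i, E i != 0,
      forall i, (E i)^T = E i,
      forall i, E i *m E i = E i &
      forall i j, i != j -> E i *m E j = 0].

                                                                                
                                          
Definition refinement (R : realType) (n : nat) (K I : finType)
    (S : K -> 'M[R]_n) (E : I -> 'M[R]_n) (pi : I -> K) : Prop :=
  orthogonal_idempotents E /\ (forall k, \sum_(i | pi i == k) E i = S k).

                                                                   
Definition lift_mx (R : realType) (n m r : nat) (f : 'I_n -> 'I_m)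
    (M : 'M[R]_m) : 'M[R]_n :=
  r%:R^-1 *: (incidence R f *m M *m (incidence R f)^T).

Definition lift_family (R : realType) (n m r : nat) (f : 'I_n -> 'I_m)
    (I : finType) (E : I -> 'M[R]_m) : I -> 'M[R]_n :=
  fun i => lift_mx r f (E i).

                                      
Definition family_sum (R : realType) (n : nat) (I : finType)
    (E : I -> 'M[R]_n) : 'M[R]_n :=
  \sum_i E i.

                                                                                 
Definition structure_balanced (R : realType) (n : nat) (I J : finType)
    (P : I -> 'M[R]_n) (Q : J -> 'M[R]_n) (lam : I -> J -> R) : Prop :=
  forall p q, Q q *m P p *m family_sum Q = lam p q *: Q q.

Definition in_Q1 (R : realType) (I J : finType) (lam : I -> J -> R) (q : J) : Prop :=
  exists p, lam p q = 1.

Definition anova_applicable (R : realType) (n : nat) (I J L : finType)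
    (lam : I -> J -> R) (Q : J -> 'M[R]_n) (Rf : L -> 'M[R]_n) : Prop :=
  forall q, Q q *m family_sum Rf != 0 -> in_Q1 lam q.

                                                                    
Definition dispersion (R : realType) (n r : nat) (I J : finType)
    (P : I -> 'M[R]_n) (Q : J -> 'M[R]_n) (xi : I -> R) (eta : J -> R) : 'M[R]_n :=
  \sum_p xi p *: P p + r%:R *: (\sum_q eta q *: Q q).

Definition component (R : realType) (T : Type) (n : nat) (X : T -> 'cV[R]_n)
    (i : 'I_n) : T -> R :=
  fun t => X t i 0.

Definition random_vector (R : realType) (d : measure_display)
    (T : measurableType d) (n : nat) (X : T -> 'cV[R]_n) : Prop :=
  forall i, measurable_fun [set: T] (component X i).

Definition mean_zero (R : realType) (d : measure_display) (T : measurableType d)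
    (Pr : probability T R) (n : nat) (X : T -> 'cV[R]_n) : Prop :=
  forall i, ('E_Pr[component X i] = 0)%E.

                                                                               
Definition has_covariance (R : realType) (d : measure_display)
    (T : measurableType d) (Pr : probability T R) (n : nat) (X : T -> 'cV[R]_n)
    (C : 'M[R]_n) : Prop :=
  (forall i, component X i \in Lfun Pr 2%:E) /\
  (forall i j, covariance Pr (component X i) (component X j) = (C i j)%:E).

Definition sigma_vector (R : realType) (T : Type) (n : nat)
    (X : T -> 'cV[R]_n) : set (set T) :=
  <<s \bigcup_(i in [set: 'I_n])
        preimage_set_system [set: T] (component X i) measurable >>.

Definition independent_vectors (R : realType) (d : measure_display)
    (T : measurableType d) (Pr : probability T R) (n m : nat)
    (X : T -> 'cV[R]_n) (Y : T -> 'cV[R]_m) : Prop :=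
  forall A B, sigma_vector X A -> sigma_vector Y B ->
    (Pr (A `&` B) = Pr A * Pr B)%E.

                                                                
Definition gls (R : realType) (n : nat) (M V : 'M[R]_n) (y : 'cV[R]_n) : 'cV[R]_n :=
  moore_penrose (M *m invmx V *m M) *m M *m invmx V *m y.

(* Main.v *)
Require Import Defs.
From mathcomp Require Import measurable_realfun.
From mathcomp.real_closed Require Import complex.

Set Implicit Arguments.
Unset Strict Implicit.
Unset Printing Implicit Defensive.

Local Open Scope classical_set_scope.
Local Open Scope ring_scope.

(* If lambda_QR <> 0 then Q P = Q for P = c(Q), so Q V = (xi_P + r eta_Q) Q and
   Q V^-1 = (xi_P + r eta_Q)^-1 Q; if lambda_QR = 0 then R Q = 0.  As
   R = R I_Q = sum_Q R Q, this expresses R V^-1 through the R Q, and R Q R =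
   lambda_QR R gives R V^-1 R = theta_R R, whose Moore-Penrose inverse is
   theta_R^-1 R.  Positivity of theta_R comes from lambda_QR >= 0 and
   sum_Q lambda_QR = 1.  V is invertible because the strata of G_1 sum to the
   identity, by simultaneous diagonalization of the commuting symmetric orbit
   matrices; Cov(Y) = V because independent square-integrable variables are
   uncorrelated. *)

(** * Symmetric matrices and orthogonal projectors over an ordered field *)

Lemma mulmx_tr_diagE (R : pzRingType) (m n : nat) (A : 'M[R]_(m, n)) (i : 'I_m) :
  (A *m A^T) i i = \sum_j A i j ^+ 2.
Proof. by rewrite mxE; apply: eq_bigr => j _; rewrite mxE expr2. Qed.

(** Each diagonal entry of [A *m A^T] is a sum of squares. Later vanishing claims reduce to this
    one. *)
Lemma mulmx_tr_eq0 (R : realDomainType) (m n : nat) (A : 'M[R]_(m, n)) :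
  A *m A^T = 0 -> A = 0.
Proof.
move=> AA0; apply/matrixP => i j; rewrite mxE.
have /eqP : (A *m A^T) i i = 0 by rewrite AA0 mxE.
rewrite mulmx_tr_diagE psumr_eq0 => [/allP/(_ j)|? _]; last exact: sqr_ge0.
by rewrite mem_index_enum sqrf_eq0 => /(_ isT)/eqP.
Qed.

(* The complex spectral theorem makes the minimal polynomial split with simple
   real roots, and that polynomial is unchanged by the extension to R[i]. *)
Lemma symmetric_diagonalizable (R : rcfType) (n : nat) (A : 'M[R]_n) :
  A^T = A -> diagonalizable A.
Proof.
case: n A => [A _|n A symA].
  by exists 1%:M; rewrite ?unitmx1//; apply/is_diag_mxP => -[].
pose f : {rmorphism R -> R[i]} := real_complex R; pose B := map_mx f A.
have realB : B \is a realmx.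
  by apply/mxOverP => i j; rewrite mxE complex_real.
have hermB : B \is hermsymmx.
  apply: realsym_hermsym => //; apply/is_hermitianmxP.
  by rewrite expr0 scale1r map_mx_id// /B matrix.map_trmx symA.
have /orthomx_spectralP EB := hermitian_normalmx hermB.
have /mxOverP spreal := hermitian_spectral_diag_real hermB.
apply/diagonalizableP.
exists (undup [seq complex.Re (spectral_diag B 0 i) | i <- enum 'I_n.+1]).
  exact: undup_uniq.
have Emin : map_poly f (mxminpoly A) = mxminpoly (diag_mx (spectral_diag B)).
  rewrite -(mxminpoly_map f A) -/B.
  apply: (simmx_minpoly (spectral_unit B)).
  apply/(simmxLR (spectral_unit B)).
  by rewrite [RHS]conjVmx ?spectral_unit.
rewrite -(dvdp_map f) Emin mxminpoly_diag rmorph_prod/=.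
rewrite (eq_bigr (fun r => 'X - (f r)%:P)) => [|r _]; last exact: map_polyXsubC.
rewrite -(big_map f xpredT (fun r => 'X - r%:P)) -undup_map_inj; last exact: complexI.
(* The spectral values are real, so embedding their real parts gives them back. *)
set s2 := map f _; suff -> : s2 = map (spectral_diag B 0) (enum 'I_n.+1) by [].
by rewrite /s2 -map_comp; apply: eq_map => i; exact/RRe_real/spreal.
Qed.

(** For a row basis [B] of [A], the projector is $B'(BB')^{-1}B$. The Gram matrix is invertible:
    $vBB'=0$ gives $(vB)(vB)'=0$, so $vB=0$, and the rows of [B] are free. *)
Lemma orthogonal_projector_exists (R : realFieldType) (m n : nat)
    (A : 'M[R]_(m, n)) :
  exists E : 'M[R]_n, [/\ E^T = E, E *m E = E & (E :=: A)%MS].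
Proof.
have [B [Bfree BA]] : exists B : 'M[R]_(\rank A, n), row_free B /\ (B :=: A)%MS.
  by exists (row_base A); split; [exact: row_base_free|exact: eq_row_base].
pose G := B *m B^T.
have GT : G^T = G by rewrite trmx_mul trmxK.
have Gu : G \in unitmx.
  rewrite -row_free_unit; apply: inj_row_free => v vG.
  have /mulmx_tr_eq0 vB : (v *m B) *m (v *m B)^T = 0.
    by rewrite trmx_mul -mulmxA [B *m _]mulmxA -/G mulmxA vG mul0mx.
  by apply: (row_free_inj Bfree); rewrite mul0mx.
have BE : B *m (B^T *m invmx G *m B) = B by rewrite !mulmxA mulmxV// mul1mx.
exists (B^T *m invmx G *m B); split.
- by rewrite !trmx_mul trmxK trmx_inv GT mulmxA.
- by rewrite -[LHS]mulmxA BE.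
- apply: eqmx_trans BA; apply/eqmxP/andP; split.
    exact: submxMl.
  by rewrite -{1}BE submxMl.
Qed.

(** Transposing $EF=E$ gives $FE=E$, while $FE=F$. Hence a symmetric idempotent is determined by its
    row space. *)
Lemma sym_idem_eq (R : comPzRingType) (n : nat) (E F : 'M[R]_n) :
  E^T = E -> F^T = F -> E *m F = E -> F *m E = F -> E = F.
Proof. by move=> ET FT EF FE; rewrite -[LHS]ET -EF trmx_mul ET FT. Qed.

Lemma symmetrized_orbit_mx_sym (R : realType) (n : nat) (G : {group 'S_n})
    (x : 'I_n * 'I_n) :
  (symmetrized_orbit_mx R G x)^T = symmetrized_orbit_mx R G x.
Proof.
apply/matrixP => i j; rewrite !mxE; congr (_ %:R).
(* Swapping coordinates exchanges the two orbits whose union is the symmetrized orbit. *)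
suff swap (y : 'I_n * 'I_n) (a b : 'I_n) :
    (a, b) \in pair_orbit G y -> (b, a) \in pair_orbit G (y.2, y.1).
  by rewrite !finset.inE; congr nat_of_bool; apply/orP/orP => -[] /swap /=;
    rewrite -?surjective_pairing; tauto.
by case/imsetP => g gG [-> ->]; apply/imsetP; exists g.
Qed.

(** * Strata of a permutation group *)

Section Strata.
Variables (R : realType) (n : nat) (G : {group 'S_n}) (I : finType).
Variable E : I -> 'M[R]_n.
Hypothesis strataE : stratum_projectors G E.

(** Two strata with the same eigenvalues on all orbit matrices have the same row space, so they
    coincide. Otherwise some orbit matrix $A$ separates them, and evaluating $E_iAE_j$ from both
    sides forces $E_iE_j=0$. *)
Lemma strata_orthogonal : orthogonal_idempotents E.
Proof.
have [injE EP] := strataE.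
have Es i : stratum_projector G (E i) by apply/EP; exists i.
split=> [i|i|i|i j ij]; try by have [] := Es i.
have [ETi EEi _ [a Ha]] := Es i; have [ETj EEj _ [b Hb]] := Es j.
have [ab|] := pselect (a = b).
  suff /injE ij' : E i = E j by rewrite ij' eqxx in ij.
  have EiEj : (E i :=: E j)%MS by apply: eqmx_trans Ha _; rewrite ab; exact: eqmx_sym.
  apply: sym_idem_eq => //.
    have /submxP[D ->] : (E i <= E j)%MS by rewrite EiEj.
    by rewrite -mulmxA EEj.
  have /submxP[D ->] : (E j <= E i)%MS by rewrite EiEj.
  by rewrite -mulmxA EEi.
move=> nab; have [x abx] : exists x, a x != b x.
  apply: contrapT => /forallNP ab; apply: nab; apply/funext => x.
  exact/eqP/negPn/negP/ab.
have eig k c : (E k :=: \bigcap_(x : 'I_n * 'I_n)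
    eigenspace (symmetrized_orbit_mx R G x) (c x))%MS ->
    E k *m symmetrized_orbit_mx R G x = c x *: E k.
  by move=> Hc; apply/eigenspaceP; rewrite Hc; apply: (bigcapmx_inf x).
(* Symmetry of the orbit matrix lets it act on [E j] from the left. *)
have Eij : a x *: (E i *m E j) = b x *: (E i *m E j).
  rewrite scalemxAl -(eig _ _ Ha) -mulmxA.
  rewrite -{1}[E j]ETj -{1}[symmetrized_orbit_mx R G x]symmetrized_orbit_mx_sym.
  by rewrite -trmx_mul (eig _ _ Hb) linearZ/= ETj scalemxAr.
have /eqP : (a x - b x) *: (E i *m E j) = 0 by rewrite scalerBl Eij subrr.
by rewrite scaler_eq0 subr_eq0 (negbTE abx) => /eqP.
Qed.

Lemma strata_sum : stratifiable R G -> \sum_i E i = 1%:M.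
Proof.
move=> commG; have [_ _ EE Eo] := strata_orthogonal; have [_ EP] := strataE.
pose As := [seq symmetrized_orbit_mx R G x | x : 'I_n * 'I_n].
have [|U Uu /allP UAs] := (@codiagonalizableP _ _ As).1.
  split=> [_ _ /mapP[x _ ->] /mapP[y _ ->]|_ /mapP[x _ ->]]; first exact: commG.
  exact/symmetric_diagonalizable/symmetrized_orbit_mx_sym.
suff UE : U *m (\sum_i E i) = U by rewrite -(mulKmx Uu (\sum_i E i)) UE mulVmx.
(* Each row of U is a common eigenvector, hence lies in one of the strata. *)
apply/row_matrixP => r; rewrite row_mul; set u := row r U.
pose a x := mxpoly.conjmx U (symmetrized_orbit_mx R G x) r r.
have eigu x : u *m symmetrized_orbit_mx R G x = a x *: u.
  have /UAs/= /diagonalizable_forPex[d Ud] : symmetrized_orbit_mx R G x \in As.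
    by apply: map_f; rewrite mem_enum.
  rewrite /u -row_mul (simmxP Uu Ud) /a (eqP Ud) row_mul row_diag_mx.
  by rewrite -scalemxAl -rowE mxE eqxx mulr1n.
(* The projector onto the common eigenspace containing [u] is nonzero, since a row of the invertible
   [U] cannot vanish. It is therefore a member of the family, and the other members annihilate [u]
   by orthogonality. *)
have [F [FT FF FA]] := orthogonal_projector_exists
  (\bigcap_(x : 'I_n * 'I_n) eigenspace (symmetrized_orbit_mx R G x) (a x))%MS.
have /submxP[v Ev] : (u <= F)%MS.
  by rewrite FA; apply/sub_bigcapmxP => x _; apply/eigenspaceP.
have uF : u *m F = u by rewrite Ev -mulmxA FF.
have F0 : F != 0.
  apply: contraTneq isT => F0; move: uF; rewrite F0 mulmx0 /u => /esym ur0.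
  by move: Uu; rewrite -row_free_unit => /row_freeP[W /(congr1 (row r))];
    rewrite row_mul ur0 mul0mx => /rowP/(_ r); rewrite !mxE eqxx => /eqP;
    rewrite eq_sym oner_eq0.
have [i Ei] : exists i, E i = F by apply/EP; split=> //; exists a.
rewrite mulmx_sumr (bigD1 i)//= Ei uF big1 ?addr0// => j ji.
by rewrite -uF -Ei -mulmxA Eo 1?eq_sym// mulmx0.
Qed.
End Strata.

(** Uniqueness of the Moore-Penrose inverse determines the value chosen by [xget]: the symmetry
    conditions force $AB=AC$ and $BA=CA$, whence $B=C$. *)
Lemma moore_penroseE (R : realType) (p q : nat)
    (A : 'M[R]_(p, q)) (B : 'M[R]_(q, p)) :
  is_moore_penrose A B -> moore_penrose A = B.
Proof.
move=> mpB; apply: xget_unique => // C mpC.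
have [ABA BAB ABs BAs] := mpB; have [ACA CAC ACs CAs] := mpC.
have EAC : A *m B = A *m C.
  by rewrite -[RHS]ACs -[in RHS]ABA -[in RHS]mulmxA trmx_mul ACs ABs mulmxA ACA.
have ECA : B *m A = C *m A.
  rewrite -[RHS]CAs -[in RHS]ABA -mulmxA mulmxA trmx_mul CAs BAs.
  by rewrite -mulmxA [A *m _]mulmxA ACA.
by rewrite -CAC -ECA -mulmxA -EAC mulmxA BAB.
Qed.

(** * Lifting matrices along an equireplicate map *)

Section Lift.
Variables (R : realType) (n m r : nat) (f : 'I_n -> 'I_m).
Hypotheses (f_equi : equireplicate r f) (r_gt0 : (0 < r)%N).

(** Each column of the incidence matrix has $r$ ones, and distinct columns have disjoint supports.
    The factor $r$ is what the normalization $r^{-1}$ in [lift_mx] cancels, making the lift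
    multiplicative. *)
Lemma incidence_trmx_mul : (incidence R f)^T *m incidence R f = r%:R%:M.
Proof.
apply/matrixP => u v; rewrite !mxE.
under eq_bigr do rewrite !mxE -natrM mulnb.
have [<-{v}|uv] := eqVneq u v.
  rewrite mulr1n -(f_equi u) -sum1_card natr_sum [RHS]big_mkcond/=.
  by apply: eq_bigr => w _; rewrite finset.inE andbb; case: (f w == u).
rewrite mulr0n big1// => w _; case: eqP => //= ->.
by rewrite (negbTE uv).
Qed.

Let r_neq0 : r%:R != 0 :> R. Proof. by rewrite pnatr_eq0 -lt0n. Qed.

Lemma lift_mxM (M N : 'M[R]_m) :
  lift_mx r f M *m lift_mx r f N = lift_mx r f (M *m N).
Proof.
rewrite /lift_mx -scalemxAl -scalemxAr; congr (_ *: _).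
rewrite !mulmxA -[_ *m _^T *m incidence _ _]mulmxA incidence_trmx_mul.
by rewrite mul_mx_scalar -!scalemxAl scalerA mulVf// scale1r.
Qed.

Lemma lift_mx_tr (M : 'M[R]_m) : (lift_mx r f M)^T = lift_mx r f M^T.
Proof. by rewrite /lift_mx linearZ/= !trmx_mul trmxK mulmxA. Qed.

Lemma lift_mx0 : lift_mx r f (0 : 'M[R]_m) = 0.
Proof. by rewrite /lift_mx mulmx0 mul0mx scaler0. Qed.

(** Sandwiching a lift between $X_f'$ and $X_f$ recovers the matrix up to a nonzero power of $r$.
    Injectivity keeps lifted idempotents nonzero. *)
Lemma lift_mx_inj : injective (@lift_mx R n m r f).
Proof.
move=> M N /(congr1 (fun L => (incidence R f)^T *m L *m incidence R f)).
rewrite /lift_mx -!scalemxAr -!scalemxAl => /(scalerI (invr_neq0 r_neq0)).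
rewrite !mulmxA !incidence_trmx_mul !mul_scalar_mx -!mulmxA !incidence_trmx_mul.
by rewrite !mul_mx_scalar !scalerA => /(scalerI (mulf_neq0 r_neq0 r_neq0)).
Qed.

(** This identifies the covariance contributed by $X_fW$ with the second term of [dispersion]. *)
Lemma lift_mx_lin_sum (I : finType) (a : I -> R) (E : I -> 'M[R]_m) :
  incidence R f *m (\sum_i a i *: E i) *m (incidence R f)^T =
  r%:R *: (\sum_i a i *: lift_mx r f (E i)).
Proof.
rewrite mulmx_sumr mulmx_suml scaler_sumr; apply: eq_bigr => i _.
by rewrite /lift_mx -scalemxAr -scalemxAl !scalerA mulrAC divff ?mul1r.
Qed.

Lemma lift_family_sum (I : finType) (E : I -> 'M[R]_m) :
  family_sum (lift_family r f E) = lift_mx r f (family_sum E).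
Proof.
by rewrite /family_sum /lift_mx mulmx_sumr mulmx_suml scaler_sumr.
Qed.

Lemma lift_orthogonal (I : finType) (E : I -> 'M[R]_m) :
  orthogonal_idempotents E -> orthogonal_idempotents (lift_family r f E).
Proof.
move=> [E0 ET EE Eo]; rewrite /lift_family; split=> [i|i|i|i j ij].
- by apply: contraNneq (E0 i) => ?; apply/eqP/lift_mx_inj; rewrite lift_mx0.
- by rewrite lift_mx_tr ET.
- by rewrite lift_mxM EE.
- by rewrite lift_mxM Eo// lift_mx0.
Qed.

End Lift.

(** * Families of orthogonal idempotents and structure balance *)

Lemma refinement_sum (R : realType) (n : nat) (K I : finType)
    (S : K -> 'M[R]_n) (E : I -> 'M[R]_n) (pi : I -> K) :
  refinement S E pi -> \sum_i E i = \sum_k S k.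
Proof.
move=> [_ ES]; rewrite (partition_big pi xpredT)//=.
by apply: eq_bigr => k _; rewrite -ES.
Qed.

(** Here $(FE-F)(FE-F)'=F-FEF=0$. With [F] a $Q$ and [E] a $P$, this turns $\lambda_{PQ}=1$ into
    $QP=Q$. *)
Lemma sym_idem_absorb (R : realDomainType) (n : nat) (E F : 'M[R]_n) :
  E^T = E -> F^T = F -> E *m E = E -> F *m F = F -> F *m E *m F = F -> F *m E = F.
Proof.
move=> ET FT EE FF FEF; apply/eqP; rewrite -subr_eq0; apply/eqP/mulmx_tr_eq0.
rewrite linearB/= trmx_mul ET FT mulmxBl !mulmxBr !mulmxA FEF -(mulmxA F E E) EE FEF FF.
by rewrite subrr.
Qed.

Section OrthogonalIdempotents.
Variables (R : realType) (n : nat) (I : finType) (E : I -> 'M[R]_n).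
Hypothesis orthE : orthogonal_idempotents E.

Lemma idem_mul_lin_sum (a : I -> R) (i : I) :
  E i *m (\sum_j a j *: E j) = a i *: E i.
Proof.
have [_ _ EE Eo] := orthE.
rewrite mulmx_sumr (bigD1 i)//= -scalemxAr EE big1 ?addr0// => j ji.
by rewrite -scalemxAr Eo 1?eq_sym// scaler0.
Qed.

Lemma family_sum_mul_idem (i : I) : family_sum E *m E i = E i.
Proof.
have [_ _ EE Eo] := orthE.
by rewrite mulmx_suml (bigD1 i)//= EE big1 ?addr0// => j ji; rewrite Eo.
Qed.

Lemma balanced_compress (J : finType) (P : J -> 'M[R]_n) (lam : J -> I -> R) :
  structure_balanced P E lam -> forall j i, E i *m P j *m E i = lam j i *: E i.
Proof.
have [_ _ EE _] := orthE.
move=> bal j i; have := congr1 (mulmx^~ (E i)) (bal j i).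
by rewrite /= -mulmxA family_sum_mul_idem -scalemxAl EE.
Qed.

End OrthogonalIdempotents.

(** * The dispersion matrix and its inverse *)

Section Dispersion.
Variables (R : realType) (n r : nat) (I J : finType).
Variables (P : I -> 'M[R]_n) (Q : J -> 'M[R]_n) (xi : I -> R) (eta : J -> R).
Hypotheses (orthP : orthogonal_idempotents P) (sumP : \sum_p P p = 1%:M).
Hypothesis orthQ : orthogonal_idempotents Q.
Hypotheses (xi_gt0 : forall p, 0 < xi p) (eta_ge0 : forall q, 0 <= eta q).

(** If $vV=0$, then $vVv'$ is a vanishing sum of nonnegative terms, among them $\xi_P\|vP\|^2$. As
    $\xi_P>0$, every $vP$ is zero, and these sum to $v$. *)
Lemma dispersion_unit : dispersion r P Q xi eta \in unitmx.
Proof.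
have [_ PT PP _] := orthP; have [_ QT QQ _] := orthQ.
rewrite -row_free_unit; apply: inj_row_free => v vV.
have quad (E : 'M[R]_n) : E^T = E -> E *m E = E ->
    (v *m E *m v^T) 0 0 = ((v *m E) *m (v *m E)^T) 0 0.
  by move=> ET EE; rewrite trmx_mul ET mulmxA -[v *m E *m E]mulmxA EE.
have quad_ge0 (E : 'M[R]_n) : 0 <= ((v *m E) *m (v *m E)^T) 0 0.
  by rewrite mulmx_tr_diagE; apply: sumr_ge0 => j _; exact: sqr_ge0.
have : (v *m dispersion r P Q xi eta *m v^T) 0 0 = 0 by rewrite vV mul0mx mxE.
rewrite /dispersion mulmxDr mulmxDl -scalemxAr -scalemxAl !mulmx_sumr !mulmx_suml.
rewrite mxE summxE [X in _ + X]mxE summxE => /eqP.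
under eq_bigr do rewrite -scalemxAr -scalemxAl mxE quad//.
under [X in _ * X]eq_bigr do rewrite -scalemxAr -scalemxAl mxE quad//.
rewrite paddr_eq0; first last.
- by apply: mulr_ge0 => //; apply: sumr_ge0 => q _; exact: mulr_ge0.
- by apply: sumr_ge0 => p _; apply: mulr_ge0 => //; exact: ltW.
case/andP => /eqP vP0 _; rewrite -[v]mulmx1 -sumP mulmx_sumr big1// => p _.
apply: mulmx_tr_eq0; apply/matrixP => i j; rewrite !ord1 [RHS]mxE.
have /(_ p isT)/eqP := psumr_eq0P
  (fun p _ => mulr_ge0 (ltW (xi_gt0 p)) (quad_ge0 (P p))) vP0.
by rewrite mulf_eq0 gt_eqF//= => /eqP.
Qed.

Lemma idem_mul_inv_dispersion (p : I) (q : J) : Q q *m P p = Q q ->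
  Q q *m invmx (dispersion r P Q xi eta) = (xi p + r%:R * eta q)^-1 *: Q q.
Proof.
move=> QP; have QV : Q q *m dispersion r P Q xi eta = (xi p + r%:R * eta q) *: Q q.
  rewrite /dispersion mulmxDr -scalemxAr (idem_mul_lin_sum orthQ).
  by rewrite -{1}QP -mulmxA (idem_mul_lin_sum orthP) -scalemxAr QP scalerA -scalerDl.
rewrite -{2}[Q q](mulmxK dispersion_unit) QV -scalemxAl scalerA mulVf ?scale1r//.
by rewrite gt_eqF// ltr_wpDr// mulr_ge0.
Qed.

End Dispersion.

(** * Generalized least squares for one idempotent [M], in the role of $R$, with [w q] in the role
    of $(\xi_{c(Q)}+r\eta_Q)^{-1}$ *)

Section GLS.
Variables (R : realType) (n : nat) (J : finType) (Q : J -> 'M[R]_n).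
Variables (V M : 'M[R]_n) (lam w : J -> R).
Hypotheses (M_sym : M^T = M) (M_idem : M *m M = M) (M_neq0 : M != 0).
Hypothesis orthQ : orthogonal_idempotents Q.
Hypothesis MQ : M *m family_sum Q = M.
Hypothesis MQM : forall q, M *m Q q *m M = lam q *: M.

Let MQ_tr q : M *m Q q *m (M *m Q q)^T = lam q *: M.
Proof.
have [_ QT QQ _] := orthQ.
by rewrite trmx_mul QT M_sym mulmxA -[M *m _ *m _]mulmxA QQ MQM.
Qed.

(** A nonzero symmetric idempotent has a positive diagonal entry $M_{ii}$, and $\lambda M_{ii}$ is a
    diagonal entry of $(MQ)(MQ)'$, hence a sum of squares. *)
Lemma efficiency_ge0 q : 0 <= lam q.
Proof.
have MM : M *m M^T = M by rewrite M_sym.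
have Mii i : M i i = \sum_j M i j ^+ 2 by rewrite -{1}MM mulmx_tr_diagE.
have [i Mi] : exists i, 0 < M i i.
  apply: contrapT => /forallNP M0; move/eqP: M_neq0; apply.
  apply/matrixP => i j; rewrite mxE; apply/eqP; rewrite -sqrf_eq0; apply/eqP.
  apply/le_anti; rewrite sqr_ge0 andbT.
  have /negP := M0 i; rewrite -leNgt; apply: le_trans.
  by rewrite Mii (bigD1 j)//= lerDl sumr_ge0// => k _; exact: sqr_ge0.
have : 0 <= (lam q *: M) i i.
  by rewrite -MQ_tr mulmx_tr_diagE sumr_ge0// => k _; exact: sqr_ge0.
by rewrite mxE pmulr_lge0.
Qed.

Lemma efficiency_eq0 q : lam q = 0 -> M *m Q q = 0.
Proof. by move=> l0; apply: mulmx_tr_eq0; rewrite MQ_tr l0 scale0r. Qed.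

Lemma efficiency_sum : \sum_q lam q = 1.
Proof.
apply/eqP; rewrite -subr_eq0.
have /eqP : (\sum_q lam q - 1) *: M = 0.
  rewrite scalerBl scale1r scaler_suml -{2}M_idem -{2}MQ /family_sum mulmx_sumr.
  by rewrite mulmx_suml; under [X in _ - X]eq_bigr do rewrite MQM; rewrite subrr.
by rewrite scaler_eq0 (negbTE M_neq0) orbF.
Qed.

Hypothesis QV : forall q, lam q != 0 -> Q q *m invmx V = w q *: Q q.
Hypothesis w_gt0 : forall q, lam q != 0 -> 0 < w q.

Let theta := \sum_(q | lam q != 0) lam q * w q.

(** All terms are positive, and the efficiencies sum to 1, so the index set is not empty. *)
Lemma theta_gt0 : 0 < theta.
Proof.
have [q q0] : exists q, lam q != 0.
  apply: contrapT => /forallNP lam0; move: (oner_neq0 R).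
  by rewrite -efficiency_sum big1 ?eqxx// => q _; apply/eqP/negPn/negP/lam0.
rewrite /theta (bigD1 q)//= ltr_wpDr//.
  by apply: sumr_ge0 => q' /andP[q'0 _]; rewrite mulr_ge0 ?efficiency_ge0// ltW// w_gt0.
by rewrite mulr_gt0 ?w_gt0// lt_def q0 efficiency_ge0.
Qed.

Lemma mul_inv_dispersion : M *m invmx V = \sum_(q | lam q != 0) w q *: (M *m Q q).
Proof.
rewrite -{1}MQ /family_sum mulmx_sumr mulmx_suml (bigID (fun q => lam q != 0))/=.
rewrite [X in _ + X]big1 ?addr0 => [|q /negPn/eqP q0].
  by apply: eq_bigr => q q0; rewrite -mulmxA QV// scalemxAr.
by rewrite efficiency_eq0// mul0mx.
Qed.

Lemma compress_inv_dispersion : M *m invmx V *m M = theta *: M.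
Proof.
rewrite mul_inv_dispersion mulmx_suml scaler_suml; apply: eq_bigr => q _.
by rewrite -scalemxAl MQM scalerA mulrC.
Qed.

Lemma glsE y : gls M V y = (theta^-1 *: (M *m invmx V)) *m y.
Proof.
rewrite /gls compress_inv_dispersion; congr (_ *m y).
rewrite (@moore_penroseE _ _ _ _ (theta^-1 *: M)) ?scalemxAl -?scalemxAl ?M_idem//.
have th0 : theta != 0 by rewrite gt_eqF// theta_gt0.
have E1 : theta *: M *m (theta^-1 *: M) = M.
  by rewrite -scalemxAl -scalemxAr scalerA divff// scale1r M_idem.
have E2 : theta^-1 *: M *m (theta *: M) = M.
  by rewrite -scalemxAl -scalemxAr scalerA mulVf// scale1r M_idem.
by split; rewrite ?E1 ?E2 // -scalemxAr M_idem.
Qed.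

(** With $N=\theta^{-1}MV^{-1}$, the product $NVN'$ collapses to $\theta^{-2}MV^{-1}M$. *)
Lemma gls_dispersion : V \in unitmx -> V^T = V ->
  (theta^-1 *: (M *m invmx V)) *m V *m (theta^-1 *: (M *m invmx V))^T = theta^-1 *: M.
Proof.
move=> Vu VT; rewrite linearZ/= trmx_mul trmx_inv VT M_sym -!scalemxAl mulmxKV//.
rewrite -scalemxAr mulmxA compress_inv_dispersion !scalerA mulfVK//.
by rewrite gt_eqF// theta_gt0.
Qed.

End GLS.

(** * Independence and covariance of random vectors *)

Lemma expectationM_indep (R : realType) (d d1 d2 : measure_display)
    (T : measurableType d) (T1 : measurableType d1) (T2 : measurableType d2)
    (Pr : probability T R) (X : {RV Pr >-> T1}) (Y : {RV Pr >-> T2})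
    (g : T1 -> R) (h : T2 -> R) :
  measurable_fun [set: T1] g -> measurable_fun [set: T2] h ->
  g \o X \in Lfun Pr 1 -> h \o Y \in Lfun Pr 1 ->
  (g \o X) * (h \o Y) \in Lfun Pr 1 ->
  (forall A B, measurable A -> measurable B ->
     Pr (X @^-1` A `&` Y @^-1` B) = Pr (X @^-1` A) * Pr (Y @^-1` B))%E ->
  ('E_Pr[(g \o X) * (h \o Y)] = 'E_Pr[g \o X] * 'E_Pr[h \o Y])%E.
Proof.
move=> mg mh X1 Y1 XY1 indep.
have mXY : measurable_fun [set: T] (fun t => (X t, Y t)).
  exact: measurable_fun_pair.
pose XY : {RV Pr >-> (T1 * T2)%type} := mfun_Sub (mem_set mXY).
pose f (u : (T1 * T2)%type) := (g u.1 * h u.2)%:E.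
have mf : measurable_fun setT f.
  apply/measurable_EFinP; apply: measurable_funM.
    exact: (measurableT_comp mg).
  exact: (measurableT_comp mh).
(* By independence the joint law of X and Y is the product of their laws, so
   that Fubini applies. *)
have prodE A : measurable A ->
    (distribution Pr X \x distribution Pr Y)%E A = distribution Pr XY A.
  apply: product_measure_unique => B C mB mC.
  by rewrite /distribution/= /pushforward -indep.
have prod_int (k : T1 * T2 -> \bar R) :
  (\int[distribution Pr X \x distribution Pr Y]_u k u =
   \int[distribution Pr XY]_u k u)%E.
  by apply: eq_measure_integral => A mA _; exact: prodE.
have intf : Pr.-integrable [set: T] (f \o XY) by exact/Lfun1_integrable.
(* Integrability for the product law is read off from that of the product variable, as the two laws
   agree. *)
have fint : (distribution Pr X \x distribution Pr Y)%E.-integrable setT f.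
  apply/integrableP; split => //; rewrite prod_int.
  rewrite ge0_integral_distribution//; last exact: measurableT_comp.
  by have /integrableP[] := intf.
have mhE : measurable_fun [set: T2] (EFin \o h) by exact/measurable_EFinP.
have mgE : measurable_fun [set: T1] (EFin \o g) by exact/measurable_EFinP.
have intX : (distribution Pr X).-integrable [set: T1] (EFin \o g).
  apply/integrableP; split => //.
  rewrite ge0_integral_distribution//; last exact: measurableT_comp.
  by have /Lfun1_integrable/integrableP[] := X1.
have intY : (distribution Pr Y).-integrable [set: T2] (EFin \o h).
  apply/integrableP; split => //.
  rewrite ge0_integral_distribution//; last exact: measurableT_comp.
  by have /Lfun1_integrable/integrableP[] := Y1.
rewrite unlock -[LHS](integral_distribution mf intf) -prod_int -integral12_prod_meas1//.
rewrite -[X in (_ * X)%E](integral_distribution mhE); last exact/Lfun1_integrable.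
rewrite -[X in (X * _)%E](integral_distribution mgE); last exact/Lfun1_integrable.
rewrite -(fineK (integrable_fin_num _ intY))// -integralZr//.
apply: eq_integral => x _; rewrite (fineK (integrable_fin_num _ intY))//.
rewrite /fubini_F /f/=.
by under eq_integral do rewrite EFinM; rewrite integralZl.
Qed.

Lemma Lfun2_Lfun1 (R : realType) (d : measure_display) (T : measurableType d)
    (Pr : probability T R) (X : T -> R) :
  X \in Lfun Pr 2%:E -> X \in Lfun Pr 1.
Proof. by apply: Lfun_subset12; rewrite fin_num_measure. Qed.

Lemma covariance_indep (R : realType) (d : measure_display) (T : measurableType d)
    (Pr : probability T R) (X Y : T -> R) :
  X \in Lfun Pr 2%:E -> Y \in Lfun Pr 2%:E ->
  (forall A B, measurable A -> measurable B ->
     Pr (X @^-1` A `&` Y @^-1` B) = Pr (X @^-1` A) * Pr (Y @^-1` B))%E ->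
  covariance Pr X Y = 0%E.
Proof.
move=> X2 Y2 indep.
have [[X1 Y1] XY1] := (Lfun2_Lfun1 X2, Lfun2_Lfun1 Y2, Lfun2_mul_Lfun1 X2 Y2).
rewrite covarianceE//.
have mfunL (U : T -> R) : U \in Lfun Pr 2%:E -> U \in mfun.
  by rewrite inE => /andP[].
have := @expectationM_indep R _ _ _ T R R Pr
  (mfun_Sub (mfunL _ X2)) (mfun_Sub (mfunL _ Y2)) id id.
move=> -> //; rewrite subee// fin_numM//; exact: expectation_fin_num.
Qed.


Section Covariance.
Variables (R : realType) (d : measure_display) (T : measurableType d).
Variable Pr : probability T R.

Lemma Lfun2_sum (I : Type) (s : seq I) (a : I -> R) (X : I -> T -> R) :
  (forall i, X i \in Lfun Pr 2%:E) -> (\sum_(i <- s) a i \o* X i) \in Lfun Pr 2%:E.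
Proof.
move=> X2; apply: rpred_sum => [|? i _]; first by rewrite lee1n.
by apply: Lfun_scale; rewrite ?ler1n.
Qed.

Lemma covariance_suml (I : Type) (s : seq I) (a : I -> R)
    (X : I -> T -> R) (Y : T -> R) :
  (forall i, X i \in Lfun Pr 2%:E) -> Y \in Lfun Pr 2%:E ->
  covariance Pr (\sum_(i <- s) a i \o* X i) Y =
  (\sum_(i <- s) (a i)%:E * covariance Pr (X i) Y)%E.
Proof.
move=> X2 Y2; elim: s => [|i s IHs].
  by rewrite !big_nil -(covariance_cst_l Pr 0 Y).
rewrite !big_cons covarianceDl//; last 2 first.
- by apply: Lfun_scale => //; rewrite ler1n.
- exact: Lfun2_sum.
rewrite IHs covarianceZl//; [exact: Lfun2_Lfun1|exact: Lfun2_Lfun1|].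
exact: Lfun2_mul_Lfun1.
Qed.

(** Bilinearity of covariance, with constants contributing nothing. It serves both for [Y] and for
    the estimator, which is linear in [Y]. *)
Lemma has_covariance_affine (n m : nat) (X : T -> 'cV[R]_n) (C : 'M[R]_n)
    (A : 'M[R]_(m, n)) (b : 'cV[R]_m) :
  has_covariance Pr X C -> has_covariance Pr (fun t => A *m X t + b) (A *m C *m A^T).
Proof.
move=> [X2 covX].
pose L i : T -> R := \sum_j A i j \o* component X j.
have L2 i : L i \in Lfun Pr 2%:E by exact: Lfun2_sum.
have compE i : component (fun t => A *m X t + b) i = L i \+ cst (b i 0).
  apply/funext => t; rewrite /component /= !mxE /L fct_sumE; congr (_ + _).
  by apply: eq_bigr => j _; rewrite mulrC.
have cst2 c : cst c \in Lfun Pr 2%:E by exact: Lfun_cst.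
have comp2 i : L i \+ cst (b i 0) \in Lfun Pr 2%:E.
  by apply: rpredD => [|?|?]; [rewrite lee1n|exact: L2|exact: cst2].
split=> [i|i j]; first by rewrite compE.
rewrite !compE covarianceDl// covarianceDr// covariance_cst_l covariance_cst_r.
rewrite !adde0 covariance_suml//.
(* Symmetry of the covariance reduces linearity in the second argument to the first. *)
have cov_entry k : covariance Pr (component X k) (L j) = (\sum_l A j l * C k l)%:E.
  rewrite covarianceC covariance_suml// -sumEFin; apply: eq_bigr => l _.
  by rewrite covarianceC covX EFinM.
under eq_bigr do rewrite cov_entry -EFinM.
rewrite sumEFin; congr EFin; rewrite mxE.
under eq_bigr do rewrite mulr_sumr.
rewrite exchange_big; apply: eq_bigr => l _; rewrite !mxE mulr_suml.
by apply: eq_bigr => k _; rewrite mulrA mulrAC.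
Qed.

(** Stacking the two vectors lets their combination in the model be treated as one affine image;
    independence kills the off-diagonal blocks. *)
Lemma has_covariance_col_mx (n m : nat) (X : T -> 'cV[R]_n) (Y : T -> 'cV[R]_m)
    (C : 'M[R]_n) (D : 'M[R]_m) :
  has_covariance Pr X C -> has_covariance Pr Y D -> independent_vectors Pr X Y ->
  has_covariance Pr (fun t => col_mx (X t) (Y t)) (block_mx C 0 0 D).
Proof.
move=> [X2 covX] [Y2 covY] indep.
have compl i : component (fun t => col_mx (X t) (Y t)) (lshift m i) = component X i.
  by apply/funext => t; rewrite /component col_mxEu.
have compr i : component (fun t => col_mx (X t) (Y t)) (rshift n i) = component Y i.
  by apply/funext => t; rewrite /component col_mxEd.
have covXY i j : covariance Pr (component X i) (component Y j) = 0%E.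
  (* Preimages under single components are generators of the sigma-algebras of the vectors. *)
  apply: covariance_indep => // A B mA mB; apply: indep.
    by apply: sub_sigma_algebra; exists i => //; exists A; rewrite ?setTI.
  by apply: sub_sigma_algebra; exists j => //; exists B; rewrite ?setTI.
split=> [i|i j]; first by case: (split_ordP i) => k ->; rewrite ?compl ?compr.
case: (split_ordP i) => k ->; case: (split_ordP j) => l ->;
  rewrite ?compl ?compr ?block_mxEul ?block_mxEur ?block_mxEdl ?block_mxEdr;
  rewrite ?covX ?covY ?mxE//.
by rewrite covarianceC covXY.
Qed.

End Covariance.

(** * The estimator in the model with two randomizations *)

Lemma dispersion_sym (R : realType) (n r : nat) (I J : finType)
    (P : I -> 'M[R]_n) (Q : J -> 'M[R]_n) (xi : I -> R) (eta : J -> R) :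
  (forall p, (P p)^T = P p) -> (forall q, (Q q)^T = Q q) ->
  (dispersion r P Q xi eta)^T = dispersion r P Q xi eta.
Proof.
move=> PT QT; rewrite /dispersion linearD/= linearZ/= !linear_sum/=.
by congr (_ + _); apply: eq_bigr => i _; rewrite linearZ/= ?PT ?QT.
Qed.

Theorem mainTheorem6 (R : realType) (n m k r : nat)
  (f : 'I_n -> 'I_m) (h : 'I_m -> 'I_k)
  (f_surj : surjective_map f) (h_surj : surjective_map h)
  (f_equi : equireplicate r f)
  (* the structure P, from the group G1 *)
  (G1 : {group 'S_n}) (G1_trans : transitive_perm G1)
  (G1_strat : stratifiable R G1)
  (iP : finType) (P : iP -> 'M[R]_n) (P_strata : stratum_projectors G1 P)
  (* the structure Q, from a refinement QU of the strata SU of the group G2 *)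
  (G2 : {group 'S_m}) (G2_trans : transitive_perm G2)
  (G2_strat : stratifiable R G2)
  (iS : finType) (SU : iS -> 'M[R]_m) (S_strata : stratum_projectors G2 SU)
  (iQ : finType) (QU : iQ -> 'M[R]_m) (pi : iQ -> iS)
  (Q_refines : refinement SU QU pi)
  (Q : iQ -> 'M[R]_n) (Q_def : Q = lift_family r f QU)
  (* the structure R *)
  (iR : finType) (RU : iR -> 'M[R]_m) (RU_orth : orthogonal_idempotents RU)
  (RU_sum : family_sum RU =
     incidence R h *m invmx ((incidence R h)^T *m incidence R h)
       *m (incidence R h)^T)
  (Rf : iR -> 'M[R]_n) (Rf_def : Rf = lift_family r f RU)
  (* the model *)
  (xi : iP -> R) (xi_gt0 : forall p, 0 < xi p)
  (eta : iQ -> R) (eta_ge0 : forall q, 0 <= eta q)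
  (eta_pi : forall q q', pi q = pi q' -> eta q = eta q')
  (d : measure_display) (T : measurableType d) (Pr : probability T R)
  (Z : T -> 'cV[R]_n) (W : T -> 'cV[R]_m)
  (Z_rv : random_vector Z) (W_rv : random_vector W)
  (ZW_indep : independent_vectors Pr Z W)
  (Z_mean : mean_zero Pr Z) (W_mean : mean_zero Pr W)
  (Z_cov : has_covariance Pr Z (\sum_p xi p *: P p))
  (W_cov : has_covariance Pr W (\sum_q eta q *: QU q))
  (tau : 'cV[R]_k)
  (Y : T -> 'cV[R]_n)
  (Y_def : forall t, Y t = Z t + incidence R f *m W t
                           + incidence R f *m incidence R h *m tau)
  (* structure balance *)
  (lamPQ : iP -> iQ -> R) (PQ_balanced : structure_balanced P Q lamPQ)
  (lamQR : iQ -> iR -> R) (QR_balanced : structure_balanced Q Rf lamQR)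
  (c : iQ -> iP) (c_spec : forall q, in_Q1 lamPQ q -> lamPQ (c q) q = 1)
  (anova : anova_applicable lamPQ Q Rf)
  (rho : iR) :
  let V := dispersion r P Q xi eta in
  let theta := \sum_(q | lamQR q rho != 0)
                 lamQR q rho * (xi (c q) + r%:R * eta q)^-1 in
  [/\ V \in unitmx,
      theta != 0,
      forall t, gls (Rf rho) V (Y t) =
        theta^-1 *: (\sum_(q | lamQR q rho != 0)
                       (xi (c q) + r%:R * eta q)^-1 *: (Rf rho *m Q q *m Y t)) &
      has_covariance Pr (fun t => gls (Rf rho) V (Y t)) (theta^-1 *: Rf rho)].

Proof.
move=> V theta.
have orthP := strata_orthogonal P_strata.
have sumP := strata_sum P_strata G1_strat.
have [orthQU _] := Q_refines.
(* The nonzero matrix [RU rho] forces $\Upsilon$ to be nonempty, and surjectivity of [f] then gives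
   a nonempty fibre. *)
have r_gt0 : (0 < r)%N.
  have [RU0 _ _ _] := RU_orth; have := RU0 rho.
  case: (posnP m) => [m0|m_gt0 _]; first by subst m; rewrite thinmx0 eqxx.
  have [w fw] := f_surj (Ordinal m_gt0).
  rewrite -(f_equi (Ordinal m_gt0)); apply/card_gt0P; exists w.
  by rewrite finset.inE fw.
have orthQ : orthogonal_idempotents Q by rewrite Q_def; exact: lift_orthogonal.
have orthR : orthogonal_idempotents Rf by rewrite Rf_def; exact: lift_orthogonal.
have [_ PT PP _] := orthP; have [_ QT QQ _] := orthQ; have [R0 RT RR _] := orthR.
have Vu : V \in unitmx by exact: dispersion_unit.
have VT : V^T = V by exact: dispersion_sym.
have RQ : Rf rho *m family_sum Q = Rf rho.
  rewrite Q_def Rf_def lift_family_sum /lift_family (lift_mxM f_equi r_gt0).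
  by rewrite /family_sum (refinement_sum Q_refines) (strata_sum S_strata)// mulmx1.
have RQR q : Rf rho *m Q q *m Rf rho = lamQR q rho *: Rf rho.
  exact: (balanced_compress orthR QR_balanced).
have QV q : lamQR q rho != 0 ->
    Q q *m invmx V = (xi (c q) + r%:R * eta q)^-1 *: Q q.
  move=> lam0; apply: idem_mul_inv_dispersion => //.
  (* If $QI_{\mathcal R}=0$, balance would give $\lambda_{QR}R=0$ with $R\ne0$. *)
  have Q1 : in_Q1 lamPQ q.
    apply: anova; apply: contra lam0 => /eqP QR0.
    have := QR_balanced q rho; rewrite -mulmxA QR0 mulmx0 => /esym/eqP.
    by rewrite scaler_eq0 (negbTE (R0 rho)) orbF.
  apply: sym_idem_absorb => //.
  by rewrite (balanced_compress orthQ PQ_balanced) c_spec// scale1r.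
have w_gt0 q : lamQR q rho != 0 -> 0 < (xi (c q) + r%:R * eta q)^-1.
  by move=> _; rewrite invr_gt0 ltr_wpDr// mulr_ge0.
have th_gt0 : 0 < theta by exact: (theta_gt0 (RT rho) (RR rho) (R0 rho) orthQ RQ RQR w_gt0).
have glsY y := glsE (RT rho) (RR rho) (R0 rho) orthQ RQ RQR QV w_gt0 y.
split=> //; first by rewrite gt_eqF.
  move=> t; rewrite glsY (mul_inv_dispersion (RT rho) orthQ RQ RQR QV).
  rewrite -scalemxAl mulmx_suml; congr (_ *: _).
  by apply: eq_bigr => q _; rewrite -scalemxAl.
pose N := theta^-1 *: (Rf rho *m invmx V).
have covY : has_covariance Pr Y V.
  (* [Y] is the image of the stacked vector $(Z,W)$ under $[I\;X_f]$, shifted by its mean. *)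
  have := has_covariance_affine (row_mx 1%:M (incidence R f))
    (incidence R f *m incidence R h *m tau) (has_covariance_col_mx Z_cov W_cov ZW_indep).
  congr has_covariance.
    by apply/funext => t; rewrite mul_row_col mul1mx Y_def.
  rewrite mul_row_block tr_row_mx mul_row_col !mul1mx trmx1 mulmx0 mulmx1 add0r addr0.
  by rewrite (lift_mx_lin_sum f r_gt0) /V Q_def.
have -> : (fun t => gls (Rf rho) V (Y t)) = (fun t => N *m Y t + 0).
  by apply/funext => t; rewrite addr0 glsY.
rewrite -(gls_dispersion (RT rho) (RR rho) (R0 rho) orthQ RQ RQR QV w_gt0 Vu VT).
exact: has_covariance_affine.
Qed.
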